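(* Let $\mathbb{D}$ be a division ring with an involution $x\mapsto x^\star$, and let $n\geq 2$ be an integer. Assume that $\operatorname{char}(\mathbb{D})=2$ and that $(-)^\star$ is of the first kind. Let $H:=\{x\in\mathbb{D} : x^\star=x\}$. Then every range-compatible homomorphism on $\mathcal{H}_n(\mathbb{D})$ splits as $M \mapsto MX+\Delta(M)^\alpha$ for a unique pair $(X,\alpha)$ consisting of a vector $X \in \mathbb{D}^n$ and of a root-linear mapping $\alpha : H \rightarrow \mathbb{D}$.
   Context: Division rings are associative with unity $1\neq 0$ and not assumed commutative. An involution of $\mathbb{D}$ is an endomorphism $x\mapsto x^\star$ of the group $(\mathbb{D},+)$ with $(xy)^\star=y^\star x^\star$ and $(x^\star)^\star=x$ for all $x,y$ (the identity is allowed when $\mathbb{D}$ is commutative). It leaves the center of $\mathbb{D}$ invariant; it is of the first kind if it is the identity on the center, and of the second kind otherwise. For $M=(m_{i,j})\in \mathrm{M}_n(\mathbb{D})$, set $M^\star:=(m_{j,i}^\star)$; $\mathcal{H}_n(\mathbb{D})$ denotes the additive group of all $M \in \mathrm{M}_n(\mathbb{D})$ with $M^\star=M$ (so its diagonal entries lie in $H$). A mapping $\alpha:H\to\mathbb{D}$ is root-linear if it is a homomorphism of additive groups and $\alpha(xax^\star)=x\,\alpha(a)$ for all $(x,a)\in\mathbb{D}\times H$. For $M=(m_{i,j})\in\mathrm{M}_n(\mathbb{D})$, $\Delta(M):=\begin{bmatrix} m_{1,1} & \cdots & m_{n,n}\end{bmatrix}^T\in\mathbb{D}^n$. For $X=(x_1,\dots,x_n)\in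 H^n$ and a mapping $f$ with source $H$, $X^f:=(f(x_1),\dots,f(x_n))$. $\mathbb{D}^n$ is identified with the column matrices with $n$ rows and is viewed as a right $\mathbb{D}$-vector space. The range of a matrix $M\in \mathrm{M}_n(\mathbb{D})$ is the right $\mathbb{D}$-linear span of its columns in $\mathbb{D}^n$. For an additive subgroup $\mathcal{M}$ of $\mathrm{M}_n(\mathbb{D})$, a range-compatible homomorphism on $\mathcal{M}$ is a group homomorphism $F:(\mathcal{M},+)\to(\mathbb{D}^n,+)$ such that $F(M)$ belongs to the range of $M$ for all $M\in\mathcal{M}$. *)

(* Defs.v *)
From HB Require Import structures.
From mathcomp Require Import all_boot all_order all_algebra.

Set Implicit Arguments.
Unset Strict Implicit.
Unset Printing Implicit Defensive.

Import GRing.Theory.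
Local Open Scope ring_scope.

(* A [unitRingType] is nontrivial but possibly noncommutative. *)
Definition division_ring (D : unitRingType) : Prop :=
  forall x : D, x != 0 -> x \is a GRing.unit.

Record involution (D : unitRingType) := Involution {
  inv_fun :> D -> D;
  inv_add : {morph inv_fun : x y / x + y};
  inv_mul : forall x y, inv_fun (x * y) = inv_fun y * inv_fun x;
  inv_inv : involutive inv_fun
}.

Definition central (D : unitRingType) (x : D) : Prop :=
  forall y : D, x * y = y * x.

Definition first_kind (D : unitRingType) (star : involution D) : Prop :=
  forall x : D, central x -> star x = x.

Section Hermitian.

Variables (D : unitRingType) (star : involution D).

Fact inv_fun_zmod_morphism : zmod_morphism star.
Proof.
have star0 : star 0 = 0.
  by apply: (addrI (star 0)); rewrite -inv_add !addr0.
have starN x : star (- x) = - star x.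
  by apply: (addrI (star x)); rewrite -inv_add !subrr.
by move=> x y; rewrite inv_add starN.
Qed.

HB.instance Definition _ :=
  GRing.isZmodMorphism.Build D D star inv_fun_zmod_morphism.

Definition herm_pred : {pred D} := fun x => star x == x.

Fact herm_pred_closed : zmod_closed herm_pred.
Proof.
split=> [|x y /eqP Hx /eqP Hy]; apply/eqP; first by rewrite raddf0.
by rewrite raddfB /= Hx Hy.
Qed.

HB.instance Definition _ :=
  GRing.isZmodClosed.Build D herm_pred herm_pred_closed.

Record herm := Herm { herm_val :> D; herm_valP : herm_val \in herm_pred }.

HB.instance Definition _ := [isSub for herm_val].
HB.instance Definition _ := [Choice of herm by <:].
HB.instance Definition _ := [SubChoice_isSubZmodule of herm by <:].

Fact herm_congr_subproof (x : D) (a : herm) :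
  x * herm_val a * star x \in herm_pred.
Proof.
have /eqP Ha := herm_valP a.
by apply/eqP; rewrite !inv_mul inv_inv Ha mulrA.
Qed.

Definition herm_congr (x : D) (a : herm) : herm :=
  Herm (herm_congr_subproof x a).

Definition root_linear (alpha : herm -> D) : Prop :=
  {morph alpha : a b / a + b} /\
  (forall (x : D) (a : herm), alpha (herm_congr x a) = x * alpha a).

Variable n : nat.

Definition mx_star (M : 'M[D]_n) : 'M[D]_n := \matrix_(i, j) star (M j i).

Definition hermmx_pred : {pred 'M[D]_n} := fun M => mx_star M == M.

Fact hermmx_pred_closed : zmod_closed hermmx_pred.
Proof.
split=> [|A B /eqP HA /eqP HB]; apply/eqP/matrixP=> i j.
  by rewrite !mxE raddf0.
by rewrite -[in RHS]HA -[in RHS]HB !mxE raddfB.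
Qed.

HB.instance Definition _ :=
  GRing.isZmodClosed.Build 'M[D]_n hermmx_pred hermmx_pred_closed.

Record hermmx :=
  Hermmx { hermmx_val :> 'M[D]_n; hermmx_valP : hermmx_val \in hermmx_pred }.

HB.instance Definition _ := [isSub for hermmx_val].
HB.instance Definition _ := [Choice of hermmx by <:].
HB.instance Definition _ := [SubChoice_isSubZmodule of hermmx by <:].

Fact hermmx_diag_subproof (M : hermmx) (i : 'I_n) :
  hermmx_val M i i \in herm_pred.
Proof.
have /eqP/matrixP/(_ i i) := hermmx_valP M.
by rewrite mxE => HM; apply/eqP.
Qed.

Definition hermmx_diag (M : hermmx) : 'I_n -> herm :=
  fun i => Herm (hermmx_diag_subproof M i).

Definition vec_map (f : herm -> D) (X : 'I_n -> herm) : 'cV[D]_n :=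
  \col_i f (X i).

(* The right vector space structure of D^n: MathComp's [*:] scales on the
   left. *)
Definition scale_right (v : 'cV[D]_n) (c : D) : 'cV[D]_n :=
  \col_i (v i 0 * c).

Definition in_range (M : 'M[D]_n) (v : 'cV[D]_n) : Prop :=
  exists c : 'I_n -> D, v = \sum_(j < n) scale_right (col j M) (c j).

Definition range_compatible_hom (F : hermmx -> 'cV[D]_n) : Prop :=
  {morph F : A B / A + B} /\ (forall M : hermmx, in_range M (F M)).

End Hermitian.

(* Main.v *)
Require Import Defs.
From Stdlib Require Import FunctionalExtensionality.
From mathcomp Require Import all_boot all_order all_algebra.

Set Implicit Arguments.
Unset Strict Implicit.
Unset Printing Implicit Defensive.

Import GRing.Theory.
Local Open Scope ring_scope.

(** A range-compatible [F] respects left-linear relations between rows: if row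
    [i] of [M] is [x] times row [j], the same holds for [F M]. Hence entry [i]
    of [F M] depends only on row [i] of [M] and is a sum of additive functions
    [a_i (m_ii)] and [b_ij (m_ij)]. The rank-one matrices [v a v^*] with
    [v = x e_i + e_j] give
    [a_i (x a x^* ) + b_ij (x a) = x (b_ji (a x^* ) + a_j a)].
    Polarizing in [x] at [a = 1], the defect [g x = b_ji x - x b_ji 1]
    satisfies [g (x y^* ) = x g y + y g x] and [g (x^* ) = g x]; expanding
    [g (x y z)] in two ways gives [[x, z] g y = 0]. So either [g = 0], or [D]
    is commutative, in which case the involution is the identity and [g = 0]
    because the characteristic is 2. Thus [b_ij] is [x |-> x X_j], and the
    displayed identity says that [a |-> a_i a - a X_i] is root-linear and
    independent of [i]. *)

(** * Functional equations over a division ring with involution *)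

Section Involution.

Variables (D : unitRingType) (star : involution D).

Lemma star1 : star 1 = 1.
Proof. by rewrite -[LHS]mulr1 -{2}(inv_inv star 1) -inv_mul mulr1 inv_inv. Qed.

Lemma herm1_subproof : 1 \in herm_pred star.
Proof. by apply/eqP; rewrite star1. Qed.

Definition herm1 : herm star := Herm herm1_subproof.

Lemma herm_trace_subproof (x : D) : x + star x \in herm_pred star.
Proof. by apply/eqP; rewrite inv_add inv_inv addrC. Qed.

Definition herm_trace (x : D) : herm star := Herm (herm_trace_subproof x).

(** Polarization of [x * star x]: the cross terms [x * star y] and [y * star x] form a trace. *)
Lemma herm_congr1D (x y : D) :
  herm_congr (x + y) herm1
    = herm_congr x herm1 + herm_congr y herm1 + herm_trace (x * star y).
Proof.
apply: val_inj; rewrite /= !mulr1 inv_add mulrDl !mulrDr inv_mul inv_inv.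
by rewrite (AC (2*2) ((1*4)*(2*3))).
Qed.

Lemma commutative_of_twisted_derivation (divD : division_ring D) (g : D -> D) :
    (forall x, g (star x) = g x) ->
    (forall x y, g (x * star y) = x * g y + y * g x) ->
  forall y, g y = 0 \/ (forall x z : D, x * z = z * x).
Proof.
move=> gstar gM y; have gM' u v : g (u * v) = u * g v + star v * g u.
  by rewrite -{1}(inv_inv star v) gM gstar.
have [->|/divD gy] := eqVneq (g y) 0; first by left.
right=> x z; apply: (mulIr gy); rewrite -(inv_inv star z).
(* Both expansions contain [x * y * g t] and [star t * star y * g x]; cancelling them leaves
   [x * star t * g y = star t * x * g y]. *)
set t := star z; have := congr1 g (mulrA x y t).
by rewrite !gM' inv_mul !mulrDr !mulrA -!addrA => /addrI /addIr.
Qed.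

Lemma off_diagonal_linear (divD : division_ring D) (charD2 : 2%N \in [pchar D])
    (star_first : first_kind star) (a_i a_j : herm star -> D) (b_ij b_ji : D -> D) :
    {morph a_i : a b / a + b} -> {morph b_ij : x y / x + y} ->
    {morph b_ji : x y / x + y} ->
    (forall x a, a_i (herm_congr x a) + b_ij (x * herm_val a)
       = x * (b_ji (herm_val a * star x) + a_j a)) ->
  forall x, b_ji x = x * b_ji 1.
Proof.
move=> aD bijD bjiD rank1.
have polar x y : a_i (herm_trace (x * star y))
    = x * b_ji (star y) + y * b_ji (star x).
  have Ex := rank1 x herm1; have Ey := rank1 y herm1.
  have := rank1 (x + y) herm1.
  rewrite /= !mul1r !mulr1 in Ex Ey *; rewrite herm_congr1D !aD bijD inv_add bjiD.
  rewrite (AC (3*2) ((1*4)*(2*5)*3)) /= {}Ex {}Ey mulrDl !mulrDr.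
  by rewrite [RHS](AC (3*3) ((1*3)*(5*6)*(2*4))) => /addrI.
pose g x := b_ji x - x * b_ji 1.
have g1 : g 1 = 0 by rewrite /g mul1r subrr.
(* The map [x |-> x * b_ji 1] obeys the identity [polar] with right multiplication by [b_ji 1] in
   place of [a_i], so the difference [g] inherits it. *)
have gpolar x y : a_i (herm_trace (x * star y))
    - herm_val (herm_trace (x * star y)) * b_ji 1 = x * g (star y) + y * g (star x).
  rewrite polar /g /= inv_mul inv_inv mulrDl opprD !mulrBr !mulrA.
  by rewrite addrACA.
(* Putting 1 for one argument, where [g] vanishes, shows that [g x] depends only on the trace of
   [x]. *)
have gE x : g x = a_i (herm_trace x) - herm_val (herm_trace x) * b_ji 1.
  have := gpolar 1 (star x).
  by rewrite star1 inv_inv !mul1r g1 mulr0 addr0 => <-.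
have gstar x : g (star x) = g x.
  suff traceE : herm_trace (star x) = herm_trace x by rewrite !gE traceE.
  by apply: val_inj; rewrite /= inv_inv addrC.
have gM x y : g (x * star y) = x * g y + y * g x.
  by rewrite gE gpolar !gstar.
move=> x; apply/eqP; rewrite -subr_eq0; apply/eqP; rewrite -/(g x).
have [//|Dcomm] := commutative_of_twisted_derivation divD gstar gM x.
(* Every element is now central, so the trace of [x] is [x + x = 0]. *)
have starid y : star y = y by apply: star_first => z; apply: Dcomm.
have trace0 : herm_trace x = 0.
  by apply: val_inj; rewrite /= starid addrr_pchar2.
by rewrite gE trace0 mul0r subr0; apply: (addrI (a_i 0)); rewrite -aD !addr0.
Qed.

End Involution.

(** * Entries of a range-compatible homomorphism *)

Section RangeCompatible.

Variables (D : unitRingType) (star : involution D) (n : nat).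

Lemma diag_herm_subproof (i : 'I_n) (a : herm star) :
  \matrix_(k, l) (herm_val a *+ ((k == i) && (l == i)))
    \in hermmx_pred star (n := n).
Proof.
apply/eqP/matrixP => k l; rewrite !mxE andbC raddfMn /=.
by have /eqP -> := herm_valP a.
Qed.

Definition diag_herm (i : 'I_n) (a : herm star) : hermmx star n :=
  Hermmx (diag_herm_subproof i a).

Lemma off_herm_subproof (i j : 'I_n) (x : D) :
  \matrix_(k, l) (x *+ ((k == i) && (l == j)) + star x *+ ((k == j) && (l == i)))
    \in hermmx_pred star (n := n).
Proof.
apply/eqP/matrixP => k l; rewrite !mxE raddfD !raddfMn /= inv_inv addrC.
by congr (_ *+ nat_of_bool _ + _ *+ nat_of_bool _); rewrite andbC.
Qed.

Definition off_herm (i j : 'I_n) (x : D) : hermmx star n :=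
  Hermmx (off_herm_subproof i j x).

Lemma diag_hermD (i : 'I_n) (a b : herm star) :
  diag_herm i (a + b) = diag_herm i a + diag_herm i b.
Proof. by apply: val_inj; apply/matrixP => k l; rewrite !mxE mulrnDl. Qed.

Lemma off_hermD (i j : 'I_n) (x y : D) :
  off_herm i j (x + y) = off_herm i j x + off_herm i j y.
Proof.
apply: val_inj; apply/matrixP => k l.
by rewrite !mxE inv_add !mulrnDl addrACA.
Qed.

Lemma off_herm_star (i j : 'I_n) (x : D) :
  off_herm i j (star x) = off_herm j i x.
Proof. by apply: val_inj; apply/matrixP => k l; rewrite !mxE inv_inv addrC. Qed.

Variables (F : hermmx star n -> 'cV[D]_n) (rcF : range_compatible_hom F).

(** Elements of the range combine columns with coefficients on the right, which do not interfere
    with left multiplication by [x]. *)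
Lemma range_compatible_row (M : hermmx star n) (i j : 'I_n) (x : D) :
    (forall k, hermmx_val M i k = x * hermmx_val M j k) ->
  F M i 0 = x * F M j 0.
Proof.
move=> Mij; have [c ->] := rcF.2 M.
rewrite !summxE mulr_sumr; apply: eq_bigr => k _.
by rewrite !mxE Mij mulrA.
Qed.

Lemma range_compatible_row0 (M : hermmx star n) (i : 'I_n) :
  (forall k, hermmx_val M i k = 0) -> F M i 0 = 0.
Proof.
by move=> M0; rewrite (range_compatible_row (j := i) (x := 0)) ?mul0r // => k;
  rewrite M0 mul0r.
Qed.

Lemma range_compatible0 : F 0 = 0.
Proof. by apply: (addrI (F 0)); rewrite -rcF.1 !addr0. Qed.

Lemma range_compatibleN (M : hermmx star n) : F (- M) = - F M.
Proof. by apply: (addrI (F M)); rewrite -rcF.1 !subrr range_compatible0. Qed.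

(** [diag_part i] and [off_part i j] are the functions [a_i] and [b_ij] of the opening summary. *)
Definition diag_part (i : 'I_n) (a : herm star) : D := F (diag_herm i a) i 0.

Definition off_part (i j : 'I_n) (x : D) : D := F (off_herm i j x) i 0.

Lemma diag_partD (i : 'I_n) : {morph diag_part i : a b / a + b}.
Proof. by move=> a b; rewrite /diag_part diag_hermD rcF.1 mxE. Qed.

Lemma off_partD (i j : 'I_n) : {morph off_part i j : x y / x + y}.
Proof. by move=> x y; rewrite /off_part off_hermD rcF.1 mxE. Qed.

(** The matrix [N] shares row [i] with [M], so row [i] of [M - N] vanishes, and with it entry [i] of
    [F (M - N)]. *)
Lemma range_compatible_rowE (M : hermmx star n) (i : 'I_n) :
  F M i 0 = diag_part i (hermmx_diag M i)
    + \sum_(j < n | j != i) off_part i j (hermmx_val M i j).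
Proof.
pose N := diag_herm i (hermmx_diag M i)
  + \sum_(j < n | j != i) off_herm i j (hermmx_val M i j).
have -> : F M i 0 = F N i 0.
  apply/eqP; rewrite -subr_eq0; apply/eqP.
  transitivity (F (M - N) i 0); first by rewrite rcF.1 range_compatibleN !mxE.
  apply: range_compatible_row0 => k.
  have valsum : hermmx_val (\sum_(j < n | j != i) off_herm i j (hermmx_val M i j))
      = \sum_(j < n | j != i) hermmx_val (off_herm i j (hermmx_val M i j)).
    by elim/big_rec2: _ => //= j _ A _ <-.
  have -> : hermmx_val (M - N) = hermmx_val M
      - (hermmx_val (diag_herm i (hermmx_diag M i))
         + \sum_(j < n | j != i) hermmx_val (off_herm i j (hermmx_val M i j))).
    by rewrite -valsum.
  rewrite !mxE summxE eqxx /=; apply/eqP; rewrite subr_eq0; apply/eqP.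
  have [->|ki] := eqVneq k i.
    rewrite mulr1n big1 ?addr0 // => j ji.
    by rewrite !mxE eqxx [i == j]eq_sym (negPf ji) /= !mulr0n addr0.
  rewrite mulr0n add0r (bigD1 k) //= big1 ?addr0 => [|j /andP[ji jk]].
    by rewrite !mxE !eqxx (negPf ki) /= andbF mulr1n mulr0n addr0.
  rewrite !mxE eqxx [k == j]eq_sym (negPf jk) [i == j]eq_sym (negPf ji).
  by rewrite /= !mulr0n addr0.
by rewrite rcF.1 mxE (big_morph F rcF.1 range_compatible0) summxE.
Qed.

Lemma range_compatible_rank1 (i j : 'I_n) (x : D) (a : herm star) : i != j ->
  diag_part i (herm_congr x a) + off_part i j (x * herm_val a)
    = x * (off_part j i (herm_val a * star x) + diag_part j a).
Proof.
move=> ij; have ji : j != i by rewrite eq_sym.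
have /eqP astar := herm_valP a.
(* This is [v a v^*] with [v = x e_i + e_j], so row [i] is [x] times row [j]. *)
pose M := diag_herm i (herm_congr x a) + diag_herm j a
  + off_herm i j (x * herm_val a).
have := range_compatible_row (M := M) (i := i) (j := j) (x := x).
rewrite !rcF.1 !mxE.
rewrite (range_compatible_row0 (M := diag_herm j a)) => [|k]; last first.
  by rewrite !mxE (negPf ij) mulr0n.
rewrite (range_compatible_row0 (M := diag_herm i _) (i := j)) => [|k]; last first.
  by rewrite !mxE (negPf ji) mulr0n.
rewrite -[F (off_herm i j _) j 0]/(_) -[in F _ j 0]off_herm_star inv_mul astar.
rewrite addr0 add0r [diag_part j a + _]addrC; apply => k.
rewrite !mxE !eqxx (negPf ij) (negPf ji) /= inv_mul astar.
by rewrite !mulr0n !addr0 !add0r mulrDr !mulrnAr mulrA addrC.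
Qed.

(** Rows [i] and [j] of [off_herm i k 1 + off_herm j k 1] coincide. Thus one vector [X] can serve
    all rows. *)
Lemma off_part_indep (i j k : 'I_n) : i != k -> j != k ->
  off_part i k 1 = off_part j k 1.
Proof.
have [-> //|ij] := eqVneq i j; move=> ik jk.
have := range_compatible_row (M := off_herm i k 1 + off_herm j k 1)
  (i := i) (j := j) (x := 1).
rewrite !rcF.1 !mxE.
rewrite (range_compatible_row0 (M := off_herm j k 1)) => [|l]; last first.
  by rewrite !mxE (negPf ij) (negPf ik) /= !mulr0n addr0.
rewrite (range_compatible_row0 (M := off_herm i k 1) (i := j)) => [|l]; last first.
  by rewrite !mxE [j == i]eq_sym (negPf ij) (negPf jk) /= !mulr0n addr0.
rewrite addr0 add0r mul1r; apply => l.
rewrite !mxE !eqxx [j == i]eq_sym (negPf ij) (negPf ik) (negPf jk) /=.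
by rewrite !mulr0n !addr0 add0r mul1r.
Qed.

End RangeCompatible.

Theorem theorem1p5 (D : unitRingType) (star : involution D) (n : nat)
    (divD : division_ring D) (n_ge2 : (2 <= n)%N)
    (charD2 : 2%N \in [pchar D]) (star_first : first_kind star)
    (F : hermmx star n -> 'cV[D]_n) (rcF : range_compatible_hom F) :
  exists! p : 'cV[D]_n * (herm star -> D),
    root_linear p.2 /\
    (forall M : hermmx star n,
       F M = hermmx_val M *m p.1 + vec_map p.2 (hermmx_diag M)).
Proof.
pose i0 := Ordinal (ltnW n_ge2); pose i1 := Ordinal n_ge2.
(* Since [n >= 2], each column [j] has an off-diagonal row [other j] from which [X] can be read. *)
pose other (j : 'I_n) := if j == i0 then i1 else i0.
have otherN j : other j != j.
  by rewrite /other; have [->|] := eqVneq j i0; rewrite // eq_sym.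
pose X : 'cV[D]_n := \col_j off_part F (other j) j 1.
have offE i j x : i != j -> off_part F i j x = x * X j 0.
  move=> ij; rewrite mxE (off_part_indep rcF (otherN j) ij).
  have ji : j != i by rewrite eq_sym.
  by apply: (off_diagonal_linear divD charD2 star_first (diag_partD rcF j)
    (off_partD rcF j i) (off_partD rcF i j)) => y a;
    apply: range_compatible_rank1.
pose alpha i a := diag_part F i a - herm_val a * X i 0.
have alpha_congr i j x a : i != j -> alpha i (herm_congr x a) = x * alpha j a.
  move=> ij; have := range_compatible_rank1 rcF x a ij.
  rewrite !offE // 1?eq_sym // => E.
  rewrite /alpha mulrBr mulrA; apply/eqP; rewrite subr_eq addrAC eq_sym subr_eq.
  by rewrite E mulrDr /= !mulrA addrC.
have alpha_indep i j a : i != j -> alpha i a = alpha j a.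
  move=> ij; rewrite -[RHS]mul1r -(alpha_congr i j _ _ ij); congr alpha.
  by apply: val_inj; rewrite /= star1 mul1r mulr1.
have alphaE i a : alpha i a = alpha i0 a.
  by have [->|] := eqVneq i i0; last exact: alpha_indep.
exists (X, alpha i0); split=> [|[Y beta] /= [[betaD _] FE]].
  split=> /= [|M].
    split=> [a b|x a].
      by rewrite /alpha (diag_partD rcF) mulrDl opprD addrACA.
    (* [alpha_congr] needs two distinct indices, so the left side first moves to [i1]. *)
    by rewrite -(alphaE i1) (alpha_congr i1 i0).
  apply/colP => i; rewrite range_compatible_rowE // !mxE -(alphaE i) /alpha.
  rewrite [in RHS](bigD1 i) //= [RHS]addrAC subrKC.
  by congr (_ + _); apply: eq_bigr => j ji; rewrite offE // eq_sym.
have beta0 : beta 0 = 0 by apply: (addrI (beta 0)); rewrite -betaD !addr0.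
(* Uniqueness: in row [other j], the matrix [off_herm (other j) j 1] has zero diagonal entry and
   isolates [Y j 0]. *)
have XY : X = Y.
  apply/colP => j; rewrite mxE /off_part FE !mxE.
  have -> : hermmx_diag (off_herm star (other j) j 1) (other j) = 0.
    apply: val_inj; rewrite /= mxE eqxx (negPf (otherN j)) /= !mulr0n.
    by rewrite addr0.
  rewrite beta0 addr0 (bigD1 j) //= big1 ?addr0 => [|k kj].
    by rewrite !mxE !eqxx (negPf (otherN j)) /= mulr0n addr0 mul1r.
  by rewrite !mxE (negPf kj) (negPf (otherN j)) andbF /= !mulr0n addr0 mul0r.
congr pair; first exact: XY.
(* With [Y] known, [diag_herm i0 a] determines [beta a]. *)
apply: functional_extensionality => a.
rewrite /alpha XY /diag_part FE !mxE.
have -> : hermmx_diag (diag_herm i0 a) i0 = a.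
  by apply: val_inj; rewrite /= mxE eqxx mulr1n.
rewrite (bigD1 i0) //= big1 ?addr0 => [|k ki].
  by rewrite !mxE eqxx mulr1n addrAC subrr add0r.
by rewrite !mxE (negPf ki) andbF mulr0n mul0r.
Qed.
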